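(* Let $K\ge2$ and let $\widetilde\Theta\in\mathbb R^{K\times(K-1)}$ have columns $\widetilde\Theta_l\in\mathbb R^K$, $l=1,\dots,K-1$, defined as $$\widetilde\Theta_l=\Big(\Big\{\sqrt{\frac{n\,n_{l+1}}{\sum_{i=1}^l n_i\sum_{i=1}^{l+1}n_i}}\Big\}_{l},\quad -\sqrt{\frac{n\sum_{i=1}^l n_i}{n_{l+1}\sum_{i=1}^{l+1}n_i}},\quad \{0\}_{K-1-l}\Big)^\top .$$ Then $\widetilde\Theta^\top Z^\top Z\widetilde\Theta=nI_{K-1}$ and $\widetilde\Theta^\top Z^\top Z\mathbf 1=\mathbf 0$.
   Context: $Z\in\{0,1\}^{n\times K}$ is the class indicator matrix of $n$ samples: $Z_{ik}=1$ if sample $i$ belongs to class $k\in\{1,\dots,K\}$ and $0$ otherwise, each sample belonging to exactly one class. $n_k\ge1$ is the number of samples in class $k$ (so $\sum_k n_k=n$). $\{a\}_l$ denotes a row vector of length $l$ with each element equal to $a$; $\mathbf 1\in\mathbb R^K$ is the vector of ones; $I_{K-1}$ is the identity matrix. *)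

(* Defs.v *)
From mathcomp Require Import all_boot all_order all_algebra.

Set Implicit Arguments.
Unset Strict Implicit.
Unset Printing Implicit Defensive.

Import Order.TTheory GRing.Theory Num.Theory.
Local Open Scope ring_scope.

(* Samples and classes are numbered from 0, so class k below is the class that
   is usually written k.+1.  A labelling c : 'I_n -> 'I_K encodes that each
   sample belongs to exactly one class. *)

Definition indicator_mx (R : nzRingType) (n K : nat) (c : 'I_n -> 'I_K) :
    'M[R]_(n, K) :=
  \matrix_(i, k) (c i == k)%:R.

(* The index k is a plain nat, to avoid casts between 'I_K and 'I_K.-1. *)
Definition class_size (n K : nat) (c : 'I_n -> 'I_K) (k : nat) : nat :=
  #|[set i : 'I_n | c i == k :> nat]|.

Definition cum_size (n K : nat) (c : 'I_n -> 'I_K) (l : nat) : nat :=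
  (\sum_(0 <= k < l) class_size c k)%N.

(* Column l : 'I_K.-1 is the (l.+1)-st column in 1-based numbering: its first
   l.+1 entries (rows 0, ..., l) are equal, the next one (row l.+1) is negative,
   and the remaining K - 2 - l entries vanish.  The 1-based size n_(l+2) is
   class_size c l.+1, and the 1-based sums n_1 + ... + n_(l+1) and
   n_1 + ... + n_(l+2) are cum_size c l.+1 and cum_size c l.+2. *)
Definition score_mx (R : rcfType) (n K : nat) (c : 'I_n -> 'I_K) :
    'M[R]_(K, K.-1) :=
  \matrix_(j < K, l < K.-1)
    if (j < l.+1)%N then
      Num.sqrt (n%:R * (class_size c l.+1)%:R
                / ((cum_size c l.+1)%:R * (cum_size c l.+2)%:R))
    else if (j == l.+1 :> nat) then
      - Num.sqrt (n%:R * (cum_size c l.+1)%:R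
                  / ((class_size c l.+1)%:R * (cum_size c l.+2)%:R))
    else 0.

(* Main.v *)
Require Import Defs.
From mathcomp Require Import all_boot all_order all_algebra.
From mathcomp Require Import ring.

Set Implicit Arguments.
Unset Strict Implicit.
Unset Printing Implicit Defensive.

Import Order.TTheory GRing.Theory Num.Theory.
Local Open Scope ring_scope.

(** The Gram matrix Z^T Z is diagonal with the class sizes on its diagonal, so
    both claims are about the inner product on R^K weighted by the class sizes.
    Write m for the size of class l.+1, S for the total size of the classes
    before it, S' = S + m, and a, - b for the two nonzero values of column l.

    A column is orthogonal to the all-ones vector because S * a = m * b: class
    l.+1 is balanced against the union of its predecessors
    ([score_mx_weighted_sum]). This also gives orthogonality of two columns
    l < l', since column l' is constant on the rows where column l does not
    vanish. Finally the squared norm of a column is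
    S * a ^+ 2 + m * b ^+ 2 = n * m / S' + n * S / S' = n
    ([score_mx_weighted_norm]). *)

Lemma gram_indicator_mx (R : nzRingType) (n K : nat) (c : 'I_n -> 'I_K) :
  (indicator_mx R c)^T *m indicator_mx R c =
  diag_mx (\row_k (class_size c k)%:R).
Proof.
apply/matrixP => i j; rewrite !mxE.
under eq_bigr => s _ do rewrite !mxE -natrM mulnb.
case: eqVneq => [<-|ij] /=.
  rewrite mulr1n -natr_sum; congr _%:R.
  rewrite /class_size -sum1_card [RHS]big_mkcond /=.
  by apply: eq_bigr => s _; rewrite inE andbb -val_eqE; case: (_ == _).
rewrite mulr0n big1 // => s _.
by case: eqVneq => //= ->; rewrite (negbTE ij).
Qed.

(** Separating this shape from the square roots lets one summation formula
    serve both the columns of [score_mx] and their entrywise squares. *)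
Definition step_fun (R : nmodType) (x y : R) (l j : nat) : R :=
  if (j < l.+1)%N then x else if j == l.+1 then y else 0.

Lemma weighted_sum_step_fun (R : comNzRingType) (n K : nat)
    (c : 'I_n -> 'I_K) (x y : R) (l : nat) : (l.+1 < K)%N ->
  \sum_(j < K) (class_size c j)%:R * step_fun x y l j =
  (cum_size c l.+1)%:R * x + (class_size c l.+1)%:R * y.
Proof.
move=> lK.
rewrite -(big_mkord xpredT (fun j => (class_size c j)%:R * step_fun x y l j)).
rewrite (big_cat_nat (n := l.+2)) //= [X in _ + X]big_nat [X in _ + X]big1.
  rewrite addr0 big_nat_recr //= {2}/step_fun ltnn eqxx; congr (_ + _).
  rewrite /cum_size natr_sum mulr_suml [LHS]big_nat [RHS]big_nat.
  by apply: eq_bigr => j /= jl; rewrite /step_fun jl.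
move=> j /andP[lj _].
by rewrite /step_fun ltnNge (ltnW lj) gtn_eqF // mulr0.
Qed.

Section PositiveClasses.

Variables (R : rcfType) (n K : nat) (c : 'I_n -> 'I_K).
Hypothesis class_size_gt0 : forall k : 'I_K, (1 <= class_size c k)%N.

Let head_score (l : nat) : R :=
  Num.sqrt (n%:R * (class_size c l.+1)%:R
            / ((cum_size c l.+1)%:R * (cum_size c l.+2)%:R)).
Let next_score (l : nat) : R :=
  Num.sqrt (n%:R * (cum_size c l.+1)%:R
            / ((class_size c l.+1)%:R * (cum_size c l.+2)%:R)).

Lemma score_mxE (j : 'I_K) (l : 'I_K.-1) :
  score_mx R c j l = step_fun (head_score l) (- next_score l) l j.
Proof. by rewrite mxE. Qed.

Lemma ltn_succ_pred_ord (l : 'I_K.-1) : (l.+1 < K)%N.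
Proof. by case: l => l /=; rewrite ltn_predRL. Qed.

Lemma class_size_succ_gt0 (l : 'I_K.-1) : 0 < (class_size c l.+1)%:R :> R.
Proof.
by rewrite ltr0n; exact: (class_size_gt0 (Ordinal (ltn_succ_pred_ord l))).
Qed.

Lemma cum_size_succ_gt0 (l : nat) : (l < K)%N -> 0 < (cum_size c l.+1)%:R :> R.
Proof.
move=> lK; rewrite ltr0n /cum_size big_nat_recr //=.
exact: leq_trans (class_size_gt0 (Ordinal lK)) (leq_addl _ _).
Qed.

Lemma cum_sizeS (l : nat) :
  (cum_size c l.+1)%:R = (cum_size c l)%:R + (class_size c l)%:R :> R.
Proof. by rewrite /cum_size big_nat_recr //= natrD. Qed.

(** The two radicands differ by the factor (S / m) ^+ 2. *)
Lemma next_scoreE (l : 'I_K.-1) :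
  next_score l =
  (cum_size c l.+1)%:R / (class_size c l.+1)%:R * head_score l.
Proof.
have m_gt0 := class_size_succ_gt0 l.
have S_gt0 := cum_size_succ_gt0 (ltnW (ltn_succ_pred_ord l)).
have S'_gt0 := cum_size_succ_gt0 (ltn_succ_pred_ord l).
rewrite /next_score /head_score.
rewrite -[X in _ = X * _]ger0_norm ?divr_ge0 ?ler0n //.
rewrite -sqrtr_sqr -sqrtrM ?sqr_ge0 //; congr Num.sqrt.
by field; rewrite !gt_eqF.
Qed.

Lemma score_mx_weighted_sum (l : 'I_K.-1) :
  \sum_(j < K) (class_size c j)%:R * score_mx R c j l = 0.
Proof.
under eq_bigr => j _ do rewrite score_mxE.
rewrite weighted_sum_step_fun ?ltn_succ_pred_ord // next_scoreE.
by field; rewrite gt_eqF ?class_size_succ_gt0.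
Qed.

Lemma score_mx_weighted_norm (l : 'I_K.-1) :
  \sum_(j < K) (class_size c j)%:R * score_mx R c j l ^+ 2 = n%:R.
Proof.
have m_gt0 := class_size_succ_gt0 l.
have S_gt0 := cum_size_succ_gt0 (ltnW (ltn_succ_pred_ord l)).
have S'_gt0 := cum_size_succ_gt0 (ltn_succ_pred_ord l).
have sqE j : score_mx R c j l ^+ 2 =
    step_fun (head_score l ^+ 2) ((- next_score l) ^+ 2) l j.
  rewrite score_mxE /step_fun.
  by case: ifP => // _; case: ifP => // _; rewrite expr0n.
under eq_bigr => j _ do rewrite sqE.
rewrite weighted_sum_step_fun ?ltn_succ_pred_ord // sqrrN.
rewrite !sqr_sqrtr ?divr_ge0 ?mulr_ge0 ?ler0n //.
move: S'_gt0; rewrite (cum_sizeS l.+1) => S'_gt0.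
by field; rewrite !gt_eqF.
Qed.

(** Column l vanishes below row l.+1 <= l', and column l' equals [head_score l']
    up to row l', so the inner product is a multiple of the weighted sum of
    column l. *)
Lemma score_mx_weighted_orthogonal (l l' : 'I_K.-1) : (l < l')%N ->
  \sum_(j < K) (class_size c j)%:R * (score_mx R c j l * score_mx R c j l') = 0.
Proof.
move=> ll'.
have constE j : score_mx R c j l * score_mx R c j l' =
    score_mx R c j l * head_score l'.
  rewrite !score_mxE {1 3}/step_fun.
  case: ifP => [jl|_]; first by rewrite /step_fun (leq_trans jl) // ltnS ltnW.
  by case: eqP => [->|_]; rewrite ?mul0r // /step_fun ltnS ll'.
under eq_bigr => j _ do rewrite constE mulrA.
by rewrite -mulr_suml score_mx_weighted_sum mul0r.
Qed.

End PositiveClasses.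

Theorem lemma2 (R : rcfType) (n K : nat) (hK : (2 <= K)%N)
    (c : 'I_n -> 'I_K) (hc : forall k : 'I_K, (1 <= class_size c k)%N) :
  let Z : 'M[R]_(n, K) := indicator_mx R c in
  let Theta : 'M[R]_(K, K.-1) := score_mx R c in
  Theta^T *m Z^T *m Z *m Theta = (n%:R)%:M /\
  Theta^T *m Z^T *m Z *m (const_mx 1 : 'cV[R]_K) = 0.
Proof.
move=> Z Theta.
have gramE p (B : 'M[R]_(K, p)) l k : (Theta^T *m Z^T *m Z *m B) l k =
    \sum_(j < K) (class_size c j)%:R * (Theta j l * B j k).
  rewrite -(mulmxA _ _ Z) gram_indicator_mx mul_mx_diag mxE.
  by apply: eq_bigr => j _; rewrite !mxE mulrAC mulrC.
split; apply/matrixP => l k; rewrite gramE.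
  rewrite !mxE -val_eqE; case: ltngtP => [lk|kl|/val_inj <-] /=.
  - by rewrite mulr0n score_mx_weighted_orthogonal.
  - under eq_bigr => j _ do rewrite (mulrC (Theta j l)).
    by rewrite mulr0n score_mx_weighted_orthogonal.
  - by rewrite mulr1n score_mx_weighted_norm.
under eq_bigr => j _ do rewrite [const_mx _ _ _]mxE mulr1.
by rewrite mxE score_mx_weighted_sum.
Qed.
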